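(* For every positive integer $k$, the quantity $\Lambda(k,2)$ is finite.
   Context: Let $k,m$ be positive integers and $p$ a prime. An integer $r$ is called a $k$th power residue modulo $p$ if $0<r<p$ and the residue class of $r$ is a $k$th power in $\mathbb{Z}_p:=\mathbb{Z}/p\mathbb{Z}$. For fixed $k,m$, for all but finitely many primes $p$ (the finitely many others being called exceptional) there exists an integer $r>0$ such that $r,r+1,\dots,r+m-1$ are all $k$th power residues modulo $p$ (so in particular all of them lie strictly between $0$ and $p$). For a non-exceptional prime $p$, i.e. one for which such an $r$ exists, let $r(k,m,p)$ be the minimal such integer $r>0$. Define $\Lambda(k,m)$ to be the maximum of $r(k,m,p)$ over all non-exceptional primes $p$, and set $\Lambda(k,m)=\infty$ if this maximum does not exist (i.e. if the values $r(k,m,p)$ are unbounded). *)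

(* Defs.v *)
From mathcomp Require Import all_boot all_order all_algebra.
From mathcomp Require Import boolp classical_sets.

Set Implicit Arguments.
Unset Strict Implicit.
Unset Printing Implicit Defensive.

Import GRing.Theory.

Local Open Scope nat_scope.
Local Open Scope classical_set_scope.

(** For [p] prime, ['F_p] is Z/pZ; [p] is always required to be prime below. *)
Definition power_residue (k p r : nat) : bool :=
  (0 < r < p) && [exists x : 'F_p, (x ^+ k == r%:R)%R].

(** [r], [r + 1], ..., [r + m - 1] are all [k]th power residues modulo [p]. *)
Definition residue_run (k m p r : nat) : bool :=
  (0 < r) && [forall i : 'I_m, power_residue k p (r + i)].

Definition nonexceptional (k m p : nat) : Prop :=
  prime p /\ exists r, residue_run k m p r.

Definition least_run (k m p : nat) (h : nonexceptional k m p) : nat :=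
  ex_minn (proj2 h).

Definition least_runs (k m : nat) : set nat :=
  [set r | exists (p : nat) (h : nonexceptional k m p), r = least_run h].

(** The maximum of [least_runs k m] as an element of the naturals extended
    with infinity: [Some M] if [M] is the maximum, and [None] (infinity) if
    there is no maximum. *)
Definition Lambda (k m : nat) : option nat :=
  xget None (Some @` (least_runs k m `&` ubound (least_runs k m))).

(* Main.v *)
Require Import Defs.
From mathcomp Require Import all_boot all_order all_algebra.
From mathcomp Require Import all_fingroup all_solvable.
From mathcomp Require Import boolp classical_sets.
From mathcomp Require Import zify.

(** The proof is of Schur type. Colour the nonzero residues modulo [p] by their
    class modulo [k]th powers, which takes at most [k] colours because the
    multiplicative group is cyclic ([power_class_coloring]). Fix, independently
    of [p], integers [x_0 < x_1 < ...] such that [x_j - x_i] divides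
    [x_l - x_j] whenever [i < j < l] ([chain_dvd]). Ramsey's theorem for
    triangles ([monochromatic_triangle]), applied to the colour of [x_j - x_i]
    on the edge [{i, j}], gives [i < j < l] such that [a = x_j - x_i],
    [b = x_l - x_j] and [a + b = x_l - x_i] have the same colour. Since [a]
    divides [b], the quotients [b / a] and [(a + b) / a = b / a + 1] are
    consecutive integers, and both are [k]th powers modulo [p].

    Ramsey's theorem applies to [x_0], ..., [x_N] for some [N] depending only
    on [k], so every prime [p > x_N] has a run of length two starting at most
    at [x_N] ([residue_pair_bound]). For [p <= x_N] any run starts below [p], hence
    below [x_N]. The least runs are therefore bounded, and they exist because
    there are primes above [x_N]; so they have a maximum. *)

Set Implicit Arguments.
Unset Strict Implicit.
Unset Printing Implicit Defensive.

Import GRing.Theory.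

Local Open Scope nat_scope.

Lemma pigeonhole_seq (S : Type) (T : eqType) (f : S -> T) (m : nat)
    (C : seq T) (s : seq S) :
  all (fun x => f x \in C) s -> size C * m < size s ->
  exists2 t, t \in C & m < count (fun x => f x == t) s.
Proof.
elim: C s => [|t C IHC] s /=; first by case: s.
move=> sC ltCs; have [lt_mt | le_tm] := ltnP m (count (fun x => f x == t) s).
  by exists t; rewrite ?mem_head.
have [||u uC lt_mu] := IHC [seq x <- s | f x != t].
- rewrite all_filter; apply: sub_all sC => x /=.
  by rewrite inE; case: eqP.
- rewrite size_filter -(ltn_add2l (count (fun x => f x == t) s)) count_predC.
  by apply: leq_ltn_trans ltCs; rewrite mulSn leq_add2r.
exists u; first by rewrite inE uC orbT.
apply: leq_trans lt_mu _; rewrite count_filter.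
by apply: sub_count => x /= /andP[].
Qed.

(** The recursion of Schur's argument: one vertex, plus enough others to force
    more than [triangle_bound n] of them to be joined to it in one colour. *)
Fixpoint triangle_bound (n : nat) : nat :=
  if n is n'.+1 then (n * triangle_bound n').+1 else 1.

(** Among the vertices joined to the least vertex [v] in the colour [t], an edge
    of colour [t] closes a triangle with [v]; without such an edge, these
    vertices span one colour fewer. *)
Lemma monochromatic_triangle (T : eqType) (c : nat -> nat -> T) (C : seq T)
    (s : seq nat) :
  sorted ltn s -> triangle_bound (size C) < size s ->
  {in s &, forall i j, i < j -> c i j \in C} ->
  exists i j l, [/\ l \in s, i < j < l, c i j = c j l & c i j = c i l].
Proof.
move Dn: (size C) => n.
elim: n C Dn s => [|n IHn] C Dn [|v s] //= sorted_s lt_s cC.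
  case: s sorted_s lt_s cC => [|w s] //= /andP[lt_vw _] _ cC.
  have := cC v w; rewrite !inE !eqxx orbT (size0nil Dn) => /(_ isT isT lt_vw).
  by [].
have lt_v : all (ltn v) s by apply: order_path_min sorted_s; apply: ltn_trans.
have v_s i : i \in s -> v < i by move/(allP lt_v).
have [||t tC lt_t] := @pigeonhole_seq _ _ (c v) (triangle_bound n) C s.
- apply/allP => i si; apply: cC (v_s i si); rewrite inE ?eqxx //.
  by rewrite si orbT.
- by rewrite Dn -ltnS.
set s' := [seq i <- s | c v i == t].
have s's i : i \in s' -> (i \in s) /\ c v i = t.
  by rewrite mem_filter => /andP[/eqP].
have [/hasP[i s'i /hasP[j s'j /andP[lt_ij /eqP cij]]] | no_t] :=
  boolP (has (fun i => has (fun j => (i < j) && (c i j == t)) s') s').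
  have [[si ci] [sj cj]] := (s's i s'i, s's j s'j).
  exists v, i, j; rewrite inE sj orbT v_s // lt_ij; split=> //.
    by rewrite ci cij.
  by rewrite ci cj.
have sorted_s' : sorted ltn s'.
  by apply: sorted_filter; [apply: ltn_trans | apply: path_sorted sorted_s].
have lt_s' : triangle_bound n < size s' by rewrite size_filter.
have cC' : {in s' &, forall i j, i < j -> c i j \in rem t C}.
  move=> i j s'i s'j lt_ij.
  have [[si _] [sj _]] := (s's i s'i, s's j s'j).
  have cijC : c i j \in C by apply: cC; rewrite ?inE ?si ?sj ?orbT.
  have nt : c i j != t.
    apply: contra no_t => cij; apply/hasP; exists i => //.
    by apply/hasP; exists j; rewrite ?lt_ij.
  have := perm_mem (perm_to_rem tC) (c i j).
  by rewrite cijC inE (negPf nt) /= => <-.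
have size_rem_t : size (rem t C) = n by rewrite size_rem // Dn.
have [i [j [l [s'l ltijl cjl cil]]]] := IHn _ size_rem_t _ sorted_s' lt_s' cC'.
have [sl _] := s's l s'l.
by exists i, j, l; rewrite inE sl orbT.
Qed.

(** All earlier differences lie between [1] and the current term, so its
    factorial is a common multiple of them. *)
Fixpoint chain (n : nat) : nat :=
  if n is n'.+1 then chain n' + (chain n')`! else 0.

Lemma chain_lt : {homo chain : i j / i < j}.
Proof.
apply: homo_ltn; first exact: ltn_trans.
by move=> i /=; rewrite -[ltnLHS]addn0 ltn_add2l fact_gt0.
Qed.

Lemma chain_le : {homo chain : i j / i <= j}.
Proof. exact: ltnW_homo chain_lt. Qed.

Lemma chain_dvd i j l : i < j -> j <= l ->
  chain j - chain i %| chain l - chain j.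
Proof.
move=> lt_ij; elim: l => [|l IHl]; first by case: j lt_ij.
rewrite leq_eqVlt => /orP[/eqP-> | lt_jl]; first by rewrite subnn dvdn0.
have le_jl : chain j <= chain l by apply: chain_le.
rewrite /= -addnC -addnBA // dvdn_add ?IHl //.
apply: dvdn_fact; rewrite subn_gt0 chain_lt //=.
exact: leq_trans (leq_subr _ _) le_jl.
Qed.

(** The colour of [x] is its discrete logarithm reduced modulo [k]: if two
    logarithms agree modulo [k], their difference is a multiple of [k]. *)
Lemma power_class_coloring (F : finFieldType) (k : nat) : 0 < k ->
  exists c : F -> 'I_k, forall x y : F, (x != 0)%R -> (y != 0)%R ->
    c x = c y -> exists z : F, (x = z ^+ k * y)%R.
Proof.
case: k => // k _.
have /cyclicP[g Dg] := field_unit_group_cyclic [set: {unit F}]%G.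
have log x : exists i, (x != 0)%R -> x = (val g ^+ i)%R.
  have [-> | nz_x] := eqVneq x 0%R; first by exists 0.
  have Ux : x \is a GRing.unit by rewrite unitfE.
  have /cycleP[i Di] : FinRing.unit F Ux \in <[g]>%g by rewrite -Dg inE.
  by exists i => _; rewrite -FinRing.val_unitX -Di.
have [e De] := choice log.
exists (fun x => inord (e x %% k.+1)) => x y nz_x nz_y.
move/(congr1 val); rewrite /= !inordK ?ltn_pmod // => Exy.
have nz_g : (val g != 0)%R by rewrite -unitfE (valP g).
have split_log u : (u != 0)%R ->
    (u = (val g ^+ (e u %/ k.+1)) ^+ k.+1 * val g ^+ (e u %% k.+1))%R.
  by move=> /De {1}->; rewrite -exprM -exprD -divn_eq.
exists (val g ^+ (e x %/ k.+1) / val g ^+ (e y %/ k.+1))%R.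
rewrite [LHS](split_log x nz_x) [X in (_ = _ * X)%R](split_log y nz_y).
by rewrite Exy expr_div_n mulrA divfK // !expf_neq0.
Qed.

Lemma natr_Fp_neq0 p n : prime p -> 0 < n < p -> (n%:R != 0 :> 'F_p)%R.
Proof.
move=> p_pr /andP[n_gt0 lt_np].
by rewrite -(dvdn_pcharf (pchar_Fp p_pr)) gtnNdvd.
Qed.

Lemma residue_pair_bound k : 0 < k -> exists M, forall p, prime p -> M < p ->
  exists2 r, r <= M & residue_run k 2 p r.
Proof.
move=> k_gt0; exists (chain (triangle_bound k)) => p p_pr lt_p.
have [c Dc] := power_class_coloring 'F_p k_gt0.
pose d i j := chain j - chain i.
have lt_s : triangle_bound (size (enum 'I_k)) <
    size (iota 0 (triangle_bound k).+1) by rewrite size_enum_ord size_iota.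
have [|i [j [l [s_l /andP[lt_ij lt_jl] cjl cil]]]] :=
  monochromatic_triangle (c := fun i j => c (d i j)%:R%R)
    (iota_ltn_sorted 0 _) lt_s.
  by move=> *; rewrite mem_enum.
have le_l : chain l <= chain (triangle_bound k).
  by apply: chain_le; rewrite mem_iota in s_l.
have [ltij ltjl] := (chain_lt lt_ij, chain_lt lt_jl).
have /dvdnP[r Dr] : d i j %| d j l by apply: chain_dvd (ltnW lt_jl).
have Dr1 : d i l = r.+1 * d i j by rewrite mulSn -Dr /d; lia.
have a_gt0 : 0 < d i j by rewrite subn_gt0.
have r_gt0 : 0 < r.
  by case: r Dr {Dr1} => // /eqP; rewrite mul0n subn_eq0 leqNgt ltjl.
have le_r : r.+1 <= chain (triangle_bound k).
  apply: leq_trans le_l; apply: leq_trans (leq_subr (chain i) _).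
  by rewrite -/(d i l) Dr1 leq_pmulr.
have nz_a : ((d i j)%:R != 0 :> 'F_p)%R.
  apply: natr_Fp_neq0; rewrite // a_gt0 /d; lia.
have residue n u v : 0 < n < p -> 0 < d u v < p -> d u v = n * d i j ->
    c (d i j)%:R%R = c (d u v)%:R%R -> power_residue k p n.
  move=> n_p uv_p Duv cuv; rewrite /power_residue n_p /=.
  have [||z Dz] := Dc (d u v)%:R%R (d i j)%:R%R _ _ (esym cuv) => //.
    exact: natr_Fp_neq0.
  apply/existsP; exists z; apply/eqP; apply: (mulIf nz_a).
  by rewrite -Dz Duv natrM.
exists r; first exact: ltnW.
rewrite /residue_run r_gt0; apply/forallP => -[[|[|//]] lt_i2] /=.
  rewrite addn0; apply: (residue r j l) => //; rewrite /d; lia.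
rewrite addn1; apply: (residue r.+1 i l) => //; rewrite /d; lia.
Qed.

Lemma Lambda_finite k m B : (exists r, least_runs k m r) ->
  (forall r, least_runs k m r -> r <= B) -> exists M, Lambda k m = Some M.
Proof.
move=> [r0 run_r0] leB.
have exP : exists r, `[< least_runs k m r >] by exists r0; apply/asboolP.
have ubP r : `[< least_runs k m r >] -> r <= B by move/asboolP/leB.
have [M /asboolP run_M maxM] := ex_maxnP exP ubP.
rewrite /Lambda; case: xgetP => [_ _ [n _ <-] | noM]; first by exists n.
case: (noM (Some M)); exists M => //; split=> // r run_r.
by rewrite leEnat; apply: maxM; apply/asboolP.
Qed.

Theorem theorem1 : forall k : nat, (0 < k)%N ->
  exists M : nat, Lambda k 2 = Some M.
Proof.
move=> k k_gt0; have [M run_M] := residue_pair_bound k_gt0.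
apply: (@Lambda_finite k 2 M) => [|_ [p [h ->]]].
  have [p lt_Mp p_pr] := prime_above M.
  have [r _ run_r] := run_M p p_pr lt_Mp.
  have h : nonexceptional k 2 p by split; last exists r.
  by exists (least_run h), p, h.
rewrite /least_run; case: ex_minnP => r run_r min_r.
have [le_pM | lt_Mp] := leqP p M; last first.
  have [q le_qM /min_r le_rq] := run_M p (proj1 h) lt_Mp.
  exact: leq_trans le_qM.
(* Residues lie below [p], so the run itself starts below [M]. *)
have /andP[_ /forallP/(_ ord0)/andP[/andP[_ lt_rp] _]] := run_r.
by move: lt_rp; rewrite addn0 => /ltnW/leq_trans; apply.
Qed.
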